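(* Let $\mathcal{L}$ be a multi-sorted first-order language with set of basic sorts $\mathcal{A}$, and let $\mu,\nu$ be two labelled $\mathcal{L}$-structures, regarded as points of the space $\mathcal{M}_0=\mathcal{M}_0(\mathcal{L})$. Then $\mu$ belongs to the closure of $\nu$ if and only if: (1) for each $A\in\mathcal{A}$, $K_\mu^A\subseteq K_\nu^A$; (2) these inclusions induce functions on the underlying sets of $\mu$ and $\nu$, i.e. for each $A\in\mathcal{A}$ there is a function $A^\mu\to A^\nu$ with $v_\mu^A(k)\mapsto v_\nu^A(k)$ for all $k\in K_\mu^A$; and (3) the induced functions $A^\mu\to A^\nu$ define an $\mathcal{L}$-structure homomorphism $M_\mu\to M_\nu$.
   Context: Fix $\kappa=|\mathcal{L}|+\aleph_0$. Coherent formulas are built from atomic formulas using $\top,\bot,=,\wedge,\vee,\exists$, in a fixed finite context $x=\langle x_1:A_1,\dots,x_n:A_n\rangle$; $|M|^x=A_1^M\times\dots\times A_n^M$. A labelled $\mathcal{L}$-structure $\mu$ is an $\mathcal{L}$-structure $M_\mu$ together with, for each basic sort $A$, a subset $K^A_\mu\subseteq\kappa$ and a function $v^A_\mu:K^A_\mu\to A^{M_\mu}=A^\mu$ all of whose fibres are infinite (so $v^A_\mu$ is surjective). For $k\in\kappa^n$ and a context $x$, $k$ is defined at $\mu$ if $k_i\in K_\mu^{A_i}$ for all $i$, and then $\mu(k)=(v_\mu^{A_i}(k_i))_i$. The topology on $\mathcal{M}_0(\mathcal{L})$ has as basis the sets $V_{\varphi(k)}=\{\mu: k\text{ is defined at }\mu,\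 M_\mu\models\varphi(\mu(k))\}$ for coherent formulas $\varphi(x)$ and $k\in\kappa^n$ (in particular $V_{k,x}=\{\mu: k\text{ is defined at }\mu\}$). A homomorphism of $\mathcal{L}$-structures preserves basic functions and relations. The closure of $\nu$ is the closure of the one-point set $\{\nu\}$. *)

(* Defs.v *)
From HB Require Import structures.
From mathcomp Require Import all_boot.
From mathcomp Require Import boolp classical_sets functions cardinality topology.

Set Implicit Arguments.
Unset Strict Implicit.
Unset Printing Implicit Defensive.

Local Open Scope classical_set_scope.

Record context (S : Type) := Context {
  ctx_size : nat;
  ctx_sort :> 'I_ctx_size -> S
}.

(* A finite product X (x_1) * ... * X (x_n); for X the carriers of a
   structure M this is |M|^x. *)
Definition ctx_prod (S : Type) (X : S -> Type) (x : context S) : Type :=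
  forall i : 'I_(ctx_size x), X (x i).

Definition ctx_map (S : Type) (X Y : S -> Type) (h : forall A, X A -> Y A)
  (x : context S) (a : ctx_prod X x) : ctx_prod Y x := fun i => h (x i) (a i).

Definition ctx_rcons (S : Type) (x : context S) (A : S) : context S :=
  @Context S (ctx_size x).+1
    (fun i => if unlift ord_max i is Some j then x j else A).

Definition prod_rcons (S : Type) (X : S -> Type) (x : context S) (A : S)
    (a : ctx_prod X x) (b : X A) : ctx_prod X (ctx_rcons x A) :=
  fun i => match unlift ord_max i as o
                 return X (if o is Some j then x j else A) with
           | Some j => a j
           | None => b
           end.

(* Constants are functions with empty domain. *)
Record language := Language {
  lsort : Type;
  lfun : Type;
  lfun_dom : lfun -> context lsort;
  lfun_cod : lfun -> lsort;
  lrel : Type;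
  lrel_dom : lrel -> context lsort
}.

(* |L| counts basic sorts, functions and relations; any index type of this
   cardinality may serve as the cardinal. *)
Definition is_label_cardinal (L : language) (kappa : Type) : Prop :=
  ([set: kappa] #= [set: (lsort L + lfun L + lrel L) + nat])%card.

(* Carriers may be empty. *)
Record structure (L : language) := Structure {
  carrier :> lsort L -> Type;
  fun_interp : forall f : lfun L,
    ctx_prod carrier (lfun_dom f) -> carrier (lfun_cod f);
  rel_interp : forall r : lrel L, ctx_prod carrier (lrel_dom r) -> Prop
}.

Arguments fun_interp {L s} f a.
Arguments rel_interp {L s} r a.

Definition homomorphism (L : language) (M N : structure L)
    (h : forall A, M A -> N A) : Prop :=
  (forall (f : lfun L) (a : ctx_prod M (lfun_dom f)),
     h (lfun_cod f) (fun_interp f a) = fun_interp f (ctx_map h a)) /\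
  (forall (r : lrel L) (a : ctx_prod M (lrel_dom r)),
     rel_interp r a -> rel_interp r (ctx_map h a)).

Inductive term (L : language) (x : context (lsort L)) : lsort L -> Type :=
| Var (i : 'I_(ctx_size x)) : term x (x i)
| App (f : lfun L) (t : forall i, term x (lfun_dom f i)) : term x (lfun_cod f).

(* Formulas are intrinsically in context; the variable bound by Ex is the last
   one of the extended context. *)
Inductive coherent (L : language) : context (lsort L) -> Type :=
| Top x : coherent x
| Bot x : coherent x
| Eq x A (t u : term x A) : coherent x
| Rel x (r : lrel L) (t : forall i, term x (lrel_dom r i)) : coherent x
| And x (p q : coherent x) : coherent x
| Or x (p q : coherent x) : coherent x
| Ex x A (p : coherent (ctx_rcons x A)) : coherent x.

Fixpoint eval (L : language) (M : structure L) (x : context (lsort L))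
    (a : ctx_prod M x) (A : lsort L) (t : term x A) : M A :=
  match t with
  | Var i => a i
  | App f s => fun_interp f (fun i => eval a (s i))
  end.

Fixpoint sat (L : language) (M : structure L) (x : context (lsort L))
    (p : coherent x) : ctx_prod M x -> Prop :=
  match p with
  | Top _ => fun=> True
  | Bot _ => fun=> False
  | Eq _ _ t u => fun a => eval a t = eval a u
  | Rel _ r t => fun a => rel_interp r (fun i => eval a (t i))
  | And _ p q => fun a => sat p a /\ sat q a
  | Or _ p q => fun a => sat p a \/ sat q a
  | Ex _ A p => fun a => exists b : M A, sat p (prod_rcons a b)
  end.

Record labelled_structure (L : language) (kappa : Type) := LabelledStructure {
  lstruct :> structure L;
  labels : lsort L -> set kappa;
  label_val : forall A, labels A -> lstruct A;
  label_fibre_infinite : forall A (a : lstruct A),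
    infinite_set (@label_val A @^-1` [set a])
}.

Section Basis.
Variables (L : language) (kappa : Type).
Implicit Types (x : context (lsort L)) (mu : labelled_structure L kappa).

Definition defined_at mu x (k : 'I_(ctx_size x) -> kappa) : Prop :=
  forall i, k i \in labels mu (x i).

Definition label_point mu x (k : 'I_(ctx_size x) -> kappa)
    (d : defined_at mu k) : ctx_prod (lstruct mu) x :=
  fun i => label_val (exist _ (k i) (d i) : labels mu (x i)).

Definition basic_open x (p : coherent x) (k : 'I_(ctx_size x) -> kappa) :
    set (labelled_structure L kappa) :=
  [set mu | exists d : defined_at mu k, sat p (label_point d)].

Definition basic_opens : set (set (labelled_structure L kappa)) :=
  [set U | exists x (p : coherent x) k, U = basic_open p k].

End Basis.

(* An intersection of two basic open sets is again one: both formulas are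
   renamed into the concatenated context and conjoined. *)
Section Renaming.
Variable L : language.
Implicit Types x y : context (lsort L).

Definition renaming x y :=
  forall i : 'I_(ctx_size x), {j : 'I_(ctx_size y) | y j = x i}.

Definition cast (S : Type) (X : S -> Type) (A B : S) (e : A = B) : X A -> X B :=
  fun a => eq_rect A X a B e.

Lemma cast_id (S : Type) (X : S -> Type) (A : S) (e : A = A) (a : X A) :
  cast e a = a.
Proof. by rewrite (Prop_irrelevance e erefl). Qed.

Fixpoint trename x y (r : renaming x y) A (t : term x A) : term y A :=
  match t with
  | Var i => cast (svalP (r i)) (Var (sval (r i)))
  | App f s => App (fun i => trename r (s i))
  end.

Lemma unlift_max n : unlift (@ord_max n) ord_max = None.
Proof. exact: unlift_none. Qed.

Definition lift_renaming x y (r : renaming x y) A :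
  renaming (ctx_rcons x A) (ctx_rcons y A).
Proof.
move=> i; rewrite /=; case: (unlift ord_max i) => [j|].
  exists (lift ord_max (sval (r j))); rewrite /= liftK; exact: (svalP (r j)).
by exists ord_max; rewrite /= unlift_max.
Defined.

Fixpoint frename x (p : coherent x) : forall y, renaming x y -> coherent y :=
  match p with
  | Top _ => fun y r => Top y
  | Bot _ => fun y r => Bot y
  | Eq _ _ t u => fun y r => Eq (trename r t) (trename r u)
  | Rel _ R t => fun y r => @Rel L y R (fun i => trename r (t i))
  | And _ p q => fun y r => And (frename p r) (frename q r)
  | Or _ p q => fun y r => Or (frename p r) (frename q r)
  | Ex _ A p => fun y r => Ex (frename p (@lift_renaming _ _ r A))
  end.

Variable M : structure L.

Definition compatible x y (r : renaming x y) (a : ctx_prod M x)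
    (b : ctx_prod M y) := forall i, cast (svalP (r i)) (b (sval (r i))) = a i.

Lemma eval_cast x (a : ctx_prod M x) A B (e : A = B) (t : term x A) :
  eval a (cast e t) = cast e (eval a t).
Proof. by case: B / e. Qed.

Lemma eval_trename x y (r : renaming x y) a b A (t : term x A) :
  compatible r a b -> eval b (trename r t) = eval a t.
Proof.
move=> c; elim: t => [i|f s IH] /=; first by rewrite eval_cast.
by congr (fun_interp f _); apply: functional_extensionality_dep.
Qed.

Lemma prod_rcons_lift x A (a : ctx_prod M x) (b : M A) (i : 'I_(ctx_size x))
    (B : lsort L) (e : ctx_rcons x A (lift ord_max i) = B) (e' : x i = B) :
  cast e (prod_rcons a b (lift ord_max i)) = cast e' (a i).
Proof.
case: B / e' e; rewrite /prod_rcons /=.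
have := liftK (@ord_max (ctx_size x)) i => /= E.
move: (unlift _ _) E => o ->; move=> e; exact: cast_id.
Qed.

Lemma prod_rcons_max x A (a : ctx_prod M x) (b : M A)
    (B : lsort L) (e : ctx_rcons x A ord_max = B) (e' : A = B) :
  cast e (prod_rcons a b ord_max) = cast e' b.
Proof.
case: B / e' e; rewrite /prod_rcons /=.
have := unlift_max (ctx_size x) => /= E.
move: (unlift _ _) E => o ->; move=> e; exact: cast_id.
Qed.

Lemma compatible_lift x y (r : renaming x y) a b A (c : M A) :
  compatible r a b ->
  compatible (@lift_renaming _ _ r A) (prod_rcons a c) (prod_rcons b c).
Proof.
move=> h i; rewrite /lift_renaming [RHS]/prod_rcons /=.
case: (unlift ord_max i) => [j|] /=; last exact: (prod_rcons_max _ _ _ erefl).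
by rewrite (prod_rcons_lift _ _ _ (svalP (r j))).
Qed.

Lemma sat_frename x (p : coherent x) y (r : renaming x y) a b :
  compatible r a b -> sat (frename p r) b <-> sat p a.
Proof.
elim: p y r a b => //=.
- by move=> {}x A t u y r a b c; rewrite !(eval_trename _ c).
- move=> {}x R t y r a b c; set u := (X in rel_interp R X).
  suff -> : u = (fun i => eval a (t i)) by [].
  by apply: functional_extensionality_dep => i; exact: eval_trename.
- by move=> {}x p IHp q IHq y r a b c; rewrite (IHp _ _ _ _ c) (IHq _ _ _ _ c).
- by move=> {}x p IHp q IHq y r a b c; rewrite (IHp _ _ _ _ c) (IHq _ _ _ _ c).
move=> {}x A p IH y r a b c; split=> -[d pd]; exists d.
  by apply/(IH _ _ _ _ (compatible_lift d c)).
by apply/(IH _ _ _ _ (compatible_lift d c)).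
Qed.

End Renaming.

Section Join.
Variable L : language.
Implicit Types x y : context (lsort L).

Definition ctx_cat x y : context (lsort L) :=
  @Context _ (ctx_size x + ctx_size y)
    (fun i => match fintype.split i with inl j => x j | inr j => y j end).

Definition cat_inl x y : renaming x (ctx_cat x y).
Proof.
by move=> i; exists (lshift _ i); rewrite /= (unsplitK (inl i)).
Defined.

Definition cat_inr x y : renaming y (ctx_cat x y).
Proof.
by move=> i; exists (rshift _ i); rewrite /= (unsplitK (inr i)).
Defined.

Variable kappa : Type.
Implicit Type mu : labelled_structure L kappa.

Lemma label_point_cast mu x y (r : renaming x y)
    (k : 'I_(ctx_size x) -> kappa) (l : 'I_(ctx_size y) -> kappa)
    (d : defined_at mu k) (d' : defined_at mu l) :
  (forall i, l (sval (r i)) = k i) ->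
  compatible r (label_point d) (label_point d').
Proof.
move=> lk i; rewrite /label_point; case: (r i) (lk i) => j e /= E.
move: (d i) (d' j); rewrite E; move: (k i) => c.
case: _ / e => u v.
by rewrite (bool_irrelevance u v) cast_id.
Qed.

Lemma basic_openI x (p : coherent x) (k : 'I_(ctx_size x) -> kappa)
    y (q : coherent y) (l : 'I_(ctx_size y) -> kappa) :
  basic_opens (basic_open p k `&` basic_open q l).
Proof.
pose m (i : 'I_(ctx_size x + ctx_size y)) :=
  match fintype.split i with inl j => k j | inr j => l j end.
have ml i : m (lshift _ i) = k i by rewrite /m (unsplitK (inl i)).
have mr i : m (rshift _ i) = l i by rewrite /m (unsplitK (inr i)).
exists (ctx_cat x y),
  (And (frename p (@cat_inl x y)) (frename q (@cat_inr x y))), m.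
apply/seteqP; split=> mu /=.
  move=> [[d pd] [d' qd]].
  have D : @defined_at L kappa mu (ctx_cat x y) m.
    by move=> i; rewrite /m /=; case: (fintype.split i).
  exists D; split.
    by apply/sat_frename; [exact: label_point_cast (d) D _|exact: pd].
  by apply/sat_frename; [exact: label_point_cast (d') D _|exact: qd].
move=> [D [pd qd]].
have d : defined_at mu k.
  by move=> i; have := D (lshift _ i); rewrite ml /= (unsplitK (inl i)).
have d' : defined_at mu l.
  by move=> i; have := D (rshift _ i); rewrite mr /= (unsplitK (inr i)).
split; [exists d|exists d'].
  by move/sat_frename: pd; apply; exact: label_point_cast.
by move/sat_frename: qd; apply; exact: label_point_cast.
Qed.

Lemma basic_opens_cover :
  \bigcup_(U in @basic_opens L kappa) U = [set: labelled_structure L kappa].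
Proof.
apply/seteqP; split=> // mu _.
pose x0 := @Context (lsort L) 0 (fun i => False_rect _ (notF (ltn_ord i))).
pose k0 (i : 'I_0) : kappa := False_rect _ (notF (ltn_ord i)).
exists (@basic_open L kappa x0 (Top x0) k0); first by exists x0, (Top x0), k0.
by unshelve eexists; [case|].
Qed.

Lemma basic_opens_join (U V : set (labelled_structure L kappa)) mu :
  basic_opens U -> basic_opens V -> U mu -> V mu ->
  exists W, [/\ basic_opens W, W mu & W `<=` U `&` V].
Proof.
move=> [x [p [k ->]]] [y [q [l ->]]] Up Vq.
by exists (basic_open p k `&` basic_open q l); split=> //; exact: basic_openI.
Qed.

End Join.

Section Space.
Variables (L : language) (kappa : Type).

HB.instance Definition _ := gen_eqMixin (labelled_structure L kappa).
HB.instance Definition _ := gen_choiceMixin (labelled_structure L kappa).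
HB.instance Definition _ :=
  isBaseTopological.Build (labelled_structure L kappa)
    (@basic_opens_cover L kappa) (@basic_opens_join L kappa).

End Space.

(* Main.v *)
Require Import Defs.
From mathcomp Require Import all_boot.
From mathcomp Require Import boolp classical_sets functions cardinality topology.
(* [topology] also exports an [eval]; this makes the one of [Defs] take precedence. *)
Import Defs.

(** A point mu lies in the closure of nu iff every basic open set containing mu
  contains nu, i.e. iff nu satisfies every labelled coherent formula that mu
  satisfies. Homomorphisms preserve coherent formulas, which gives one
  direction. Conversely, preservation of [Top] gives the inclusion of labels,
  preservation of equations between labelled terms makes the induced functions
  well defined (labels are surjective) and compatible with the basic functions,
  and preservation of atomic relations does the rest. *)

Set Implicit Arguments.
Unset Strict Implicit.
Unset Printing Implicit Defensive.

Local Open Scope classical_set_scope.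

Section Homomorphism.
Context {L : language} {M N : structure L} (h : forall A, M A -> N A).
Hypothesis hom_h : homomorphism h.

Lemma homomorphism_eval (x : context (lsort L)) (a : ctx_prod M x) A
    (t : term x A) :
  h (eval a t) = eval (ctx_map h a) t.
Proof.
elim: t => [i //|f s IH] /=; rewrite (proj1 hom_h); congr (fun_interp f _).
exact: functional_extensionality_dep.
Qed.

Lemma ctx_map_rcons (x : context (lsort L)) A (a : ctx_prod M x) (b : M A) :
  ctx_map h (prod_rcons a b) = prod_rcons (ctx_map h a) (h b).
Proof.
apply: functional_extensionality_dep => i; rewrite /ctx_map /prod_rcons /=.
by case: (unlift ord_max i).
Qed.

(** Induction on [p], for all tuples at once: no connective is negative, and a witness [b] of an
    existential is carried to [h b]. *)
Lemma homomorphism_sat (x : context (lsort L)) (p : coherent x)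
    (a : ctx_prod M x) :
  sat p a -> sat p (ctx_map h a).
Proof.
elim: p a => //=.
- by move=> {}x A t u a tu; rewrite -!homomorphism_eval tu.
- move=> {}x r t a /(proj2 hom_h); congr (rel_interp r _).
  by apply: functional_extensionality_dep => i; apply: homomorphism_eval.
- by move=> {}x p IHp q IHq a [/IHp ? /IHq].
- by move=> {}x p IHp q IHq a [/IHp|/IHq]; [left|right].
by move=> {}x A p IH a [b /IH]; rewrite ctx_map_rcons; exists (h b).
Qed.

End Homomorphism.

Section Specialization.
Context {L : language} {kappa : Type}.
Implicit Types (mu nu : labelled_structure L kappa) (x y : context (lsort L)).

Lemma closure1_basic_open mu nu :
  closure [set nu] mu <->
  forall x (p : coherent x) k, basic_open p k mu -> basic_open p k nu.
Proof.
split=> [clnu x p k pmu|spec B].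
  have : nbhs mu (basic_open p k).
    rewrite nbhsE; exists (basic_open p k) => //; split=> //.
    (* Open sets are unions of families of basic ones; here the family is a singleton. *)
    exists [set basic_open p k]; last by rewrite bigcup_set1.
    by move=> _ ->; exists x, p, k.
  by move/clnu => [_ [->]].
(* The basic set [V] of the union that contains [mu] also contains [nu]. *)
rewrite nbhsE => -[U [[D Dbasic <-] [V DV Vmu]] sUB]; exists nu; split=> //.
apply: sUB; exists V => //; have [x [p [k VE]]] := Dbasic _ DV.
by move: Vmu; rewrite VE; apply: spec.
Qed.

(** Infinite fibres are nonempty. *)
Lemma label_valP mu A (a : lstruct mu A) :
  exists k : labels mu A, label_val k = a.
Proof.
have [k ka] := infinite_setN0 (@label_fibre_infinite _ _ mu A a); by exists k.
Qed.

Lemma label_val_choice mu : exists s : forall A, lstruct mu A -> labels mu A,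
  forall A a, label_val (s A a) = a.
Proof.
exists (fun A a => projT1 (cid (label_valP a))) => A a.
by case: cid.
Qed.

Definition label_cat x y (k : 'I_(ctx_size x) -> kappa)
    (l : 'I_(ctx_size y) -> kappa) (i : 'I_(ctx_size (ctx_cat x y))) : kappa :=
  match fintype.split i with inl j => k j | inr j => l j end.

Lemma label_cat_inl {x y} (k : 'I_(ctx_size x) -> kappa)
    (l : 'I_(ctx_size y) -> kappa) i : label_cat k l (lshift _ i) = k i.
Proof. by rewrite /label_cat (unsplitK (inl i)). Qed.

Lemma label_cat_inr {x y} (k : 'I_(ctx_size x) -> kappa)
    (l : 'I_(ctx_size y) -> kappa) i : label_cat k l (rshift _ i) = l i.
Proof. by rewrite /label_cat (unsplitK (inr i)). Qed.

Lemma defined_at_cat mu x y (k : 'I_(ctx_size x) -> kappa)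
    (l : 'I_(ctx_size y) -> kappa) :
  defined_at mu k -> defined_at mu l ->
  defined_at mu (x := ctx_cat x y) (label_cat k l).
Proof. by move=> dk dl i; rewrite /label_cat /=; case: fintype.split. Qed.

Section Preservation.
Variables mu nu : labelled_structure L kappa.
Hypothesis spec :
  forall x (p : coherent x) k, basic_open p k mu -> basic_open p k nu.

(** Renamed into the concatenated context, [t] and [u] form a single coherent equation. Allowing two
    contexts covers both uses: two labels of one element, and a label of a function value against
    labels of its arguments. *)
Lemma spec_eval x y A (t : term x A) (u : term y A)
    (k : 'I_(ctx_size x) -> kappa) (l : 'I_(ctx_size y) -> kappa)
    (dk : defined_at mu k) (dl : defined_at mu l)
    (dk' : defined_at nu k) (dl' : defined_at nu l) :
  eval (label_point dk) t = eval (label_point dl) u ->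
  eval (label_point dk') t = eval (label_point dl') u.
Proof.
(* Stated for any [la], as it is needed at [mu] and at [nu]. *)
have comp (la : labelled_structure L kappa) (ek : defined_at la k)
    (el : defined_at la l)
    (e : defined_at la (x := ctx_cat x y) (label_cat k l)) :
    eval (label_point e) (trename (@cat_inl _ x y) t)
      = eval (label_point ek) t /\
    eval (label_point e) (trename (@cat_inr _ x y) u)
      = eval (label_point el) u.
  by split; apply/eval_trename/label_point_cast => i;
    [apply: label_cat_inl|apply: label_cat_inr].
move=> tu; have e := defined_at_cat dk dl.
have [|e' /=] := spec (p := Eq (trename (@cat_inl _ x y) t)
                              (trename (@cat_inr _ x y) u)) (k := label_cat k l).
  by exists e => /=; have [-> ->] := comp _ dk dl e.
by have [-> ->] := comp _ dk' dl' e'.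
Qed.

Definition ctx1 (A : lsort L) : context (lsort L) :=
  @Context _ 1 (fun=> A).

Definition var1 A : term (ctx1 A) A := Var (x := ctx1 A) ord0.

Lemma defined_at1 (la : labelled_structure L kappa) A (k : labels la A) :
  defined_at la (x := ctx1 A) (fun=> \val k).
Proof. by move=> i; apply: valP. Qed.

(** Puts the value of a label in the form to which [spec_eval] applies. *)
Lemma eval_var1 (la : labelled_structure L kappa) A (k : labels la A) :
  eval (label_point (defined_at1 k)) (var1 A) = label_val k.
Proof.
rewrite /= /label_point; congr label_val; exact: val_inj.
Qed.

Lemma spec_labels A : labels mu A `<=` labels nu A.
Proof.
move=> k kmu; have [|d _] := spec (p := Top (ctx1 A)) (k := fun=> k).
  by unshelve eexists => // i; apply: mem_set.
exact: set_mem (d ord0).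
Qed.

Definition spec_label {A} (k : labels mu A) : labels nu A :=
  exist _ (\val k) (mem_set (spec_labels (set_mem (valP k)))).

Lemma spec_homomorphism : exists h : forall A, lstruct mu A -> lstruct nu A,
  (forall A (k : labels mu A) (k' : labels nu A),
    \val k = \val k' -> h A (label_val k) = label_val k') /\
  homomorphism h.
Proof.
have [s sK] := label_val_choice mu.
(* Read the chosen label of [a] in [nu]; independence of the choice is shown below. *)
pose h A (a : lstruct mu A) := label_val (spec_label (s A a)).
(* One tuple of labels names both [a] in [mu] and its image in [nu]. *)
have points x (a : ctx_prod (lstruct mu) x) : exists2 k,
    exists d : defined_at mu k, a = label_point d &
    exists d : defined_at nu k, ctx_map h a = label_point d.
  exists (fun i => \val (s _ (a i))).
    exists (fun i => valP (s _ (a i))).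
    apply: functional_extensionality_dep => i.
    rewrite -[LHS]sK; congr label_val; exact: val_inj.
  exists (fun i => valP (spec_label (s _ (a i)))).
  apply: functional_extensionality_dep => i.
  rewrite /ctx_map /h; congr label_val; exact: val_inj.
exists h; split=> [A k k' kk'|].
  have e : \val (spec_label k) = \val k' := kk'.
  (* In [mu], [k] and the label chosen for [label_val k] name the same element, and this equation
     passes to [nu]. *)
  rewrite -(val_inj e) /h -!eval_var1.
  by apply: (spec_eval (dk := defined_at1 _) (dl := defined_at1 _));
    rewrite !eval_var1 sK.
split=> [f a|r a].
  have [k [d ad] [d' ->]] := points _ a.
  (* The equation transferred is between the label chosen for the value of [f] at [a] and [f]
     applied to variables labelled by [k]. *)
  pose t := App (fun i => Var (x := lfun_dom f) i).
  rewrite /h -eval_var1 -[RHS]/(eval (label_point d') t).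
  apply: (spec_eval (dk := defined_at1 _) (dl := d)).
  by rewrite eval_var1 sK ad.
have [k [d ->] [d' ->]] := points _ a => rd.
have [|d'' /=] := spec (p := Rel (r := r) (fun i => Var i)) (k := k).
  by exists d.
by rewrite (Prop_irrelevance d'' d').
Qed.

End Preservation.

Lemma homomorphism_basic_open mu nu (h : forall A, lstruct mu A -> lstruct nu A)
    x (p : coherent x) k :
  (forall A, labels mu A `<=` labels nu A) ->
  (forall A (l : labels mu A) (l' : labels nu A),
    \val l = \val l' -> h A (label_val l) = label_val l') ->
  homomorphism h -> basic_open p k mu -> basic_open p k nu.
Proof.
move=> sub hval hom [d pd].
have d' : defined_at nu k by move=> i; apply/mem_set/sub/set_mem/d.
(* Since [h] respects labels, it maps the point named by [k] in [mu] to the one named by [k] in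
   [nu]. *)
exists d'; suff <- : ctx_map h (label_point d) = label_point d'.
  exact: homomorphism_sat.
by apply: functional_extensionality_dep => i; apply: hval.
Qed.

End Specialization.

Theorem proposition1p1p7 (L : language) (kappa : Type)
    (hkappa : is_label_cardinal L kappa)
    (mu nu : labelled_structure L kappa) :
  closure [set nu] mu <->
  (forall A : lsort L, labels mu A `<=` labels nu A) /\
  exists h : forall A : lsort L, lstruct mu A -> lstruct nu A,
    (forall (A : lsort L) (k : labels mu A) (k' : labels nu A),
       \val k = \val k' -> h A (label_val k) = label_val k') /\
    homomorphism h.
Proof.
rewrite closure1_basic_open; split=> [spec|[sub [h [hval hom]]] x p k].
  by split; [exact: spec_labels|exact: spec_homomorphism].
exact: homomorphism_basic_open hom.
Qed.
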